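(* Let $n$ be a positive odd integer and $d\geq3$ an integer with $n\equiv 1\pmod d$. For integers $k\geq0$ define $$c_q(k)=(-1)^k\frac{(1+q^{2dk+1})(q^2;q^{2d})^3_k}{(1+q)(q^{2d};q^{2d})^3_k}q^{dk^2+2k(d-1)}.$$ Then, modulo $\Phi_n(-q)^3\Phi_n(q)^2$, $$\sum_{\substack{i,j,s\geq0\\ i+j+s\leq n-1}}c_q(i)c_q(j)c_q(s)\equiv(-1)^{\frac{3(n-1)}{d}}[n]^3_{q^2}q^{\frac{3(n-1)(n+1-d)}{d}}\bigg(\sum_{k=0}^{\frac{n-1}{d}}\frac{(q^2;q^{2d})^2_k(q^d;q^{2d})_k\, q^{2(d-1)k}}{(q^{d+1},q^{2d},q^{2d+1};q^{2d})_k}\bigg)^3.$$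
   Context: Here $q$ is an indeterminate. The $q$-shifted factorial is $(a;q)_0=1$, $(a;q)_m=(1-a)(1-aq)\cdots(1-aq^{m-1})$ for $m\geq1$, and $(a_1,\dots,a_s;q)_m=(a_1;q)_m\cdots(a_s;q)_m$. $[m]_{q^2}=1+q^2+\cdots+q^{2(m-1)}$. $\Phi_n(q)$ denotes the $n$-th cyclotomic polynomial in $q$. A congruence between rational functions in $q$ modulo a polynomial $P(q)$ means that the numerator of the difference (in reduced form) is divisible by $P(q)$ while its denominator is coprime to $P(q)$. *)

(* Defs.v *)
From mathcomp Require Import all_boot all_order all_algebra all_field.

Set Implicit Arguments.
Unset Strict Implicit.
Unset Printing Implicit Defensive.

Import GRing.Theory.
Local Open Scope ring_scope.

Definition qpoch (F : fieldType) (a q : F) (m : nat) : F :=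
  \prod_(i < m) (1 - a * q ^+ i).

(* (a_1, ..., a_s; q)_m, the bases a_1, ..., a_s being given as a sequence *)
Definition qpochs (F : fieldType) (s : seq F) (q : F) (m : nat) : F :=
  \prod_(a <- s) qpoch a q m.

Definition qint (F : fieldType) (q : F) (m : nat) : F :=
  \sum_(i < m) q ^+ i.

Notation ratfun := {fraction {poly rat}}.

Definition qvar : ratfun := tofrac ('X : {poly rat}).

(* 'Phi_n has integer coefficients; the congruences are over the rationals *)
Definition Phi (n : nat) : {poly rat} := map_poly intr 'Phi_n.

(* f = g modulo P: some (equivalently, any, since reduced forms are unique up
   to a nonzero scalar) reduced form a / b of f - g has numerator divisible by
   P and denominator coprime to P *)
Definition ratfun_eqmod (P : {poly rat}) (f g : ratfun) : Prop :=
  exists a b : {poly rat},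
    [/\ b != 0, coprimep a b, f - g = tofrac a / tofrac b, P %| a & coprimep b P].

Definition cq (F : fieldType) (q : F) (d k : nat) : F :=
  (-1) ^+ k
  * (((1 + q ^+ (2 * d * k + 1)) * qpoch (q ^+ 2) (q ^+ (2 * d)) k ^+ 3)
     / ((1 + q) * qpoch (q ^+ (2 * d)) (q ^+ (2 * d)) k ^+ 3))
  * q ^+ (d * k ^ 2 + 2 * k * (d - 1)).

(* Main.v *)
(* Put p = q^(2d), N = (n - 1)/d and x = q^(2n).  Replacing two of the three
   factors (q^2; p)_k of c_q(k) by (xq^2; p)_k (q^2/x; p)_k, and (p; p)_k
   likewise, gives a sum that terminates at k = N and is evaluated exactly by a
   limiting case of Watson's 8phi7 transformation, obtained from a Bailey pair
   and the q-Chu-Vandermonde sum.  The deformation is a function of x + 1/x, and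
   x + 1/x - 2 = (1 - x)^2/x is divisible by Phi_n(q^2)^2, so undoing it costs
   nothing modulo Phi_n(q)^2 or Phi_n(-q)^2; on the right-hand side [n]_{q^2}
   cancels the only denominator factor divisible by Phi_n(q), whereas Phi_n(-q)
   survives.  Finally c_q(k) is divisible by Phi_n(q^2)^3 for N < k < n, and
   3N <= n - 1, so that the triple sum is the cube of the sum over k <= N modulo
   Phi_n(q^2)^3; cubing gives the third power of Phi_n(-q). *)
Require Import Defs.
From mathcomp Require Import all_boot all_order all_algebra all_field.
From mathcomp Require Import ring zify.

Set Implicit Arguments.
Unset Strict Implicit.
Unset Printing Implicit Defensive.

Import GRing.Theory.
Local Open Scope ring_scope.

(** * A limiting case of Watson's transformation *)

Section QPochhammer.
Variable F : fieldType.
Implicit Types a b c p q t w x y z : F.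

Lemma qpoch0 a q : qpoch a q 0 = 1.
Proof. by rewrite /qpoch big_ord0. Qed.

Lemma qpochS a q m : qpoch a q m.+1 = qpoch a q m * (1 - a * q ^+ m).
Proof. by rewrite /qpoch big_ord_recr. Qed.

Lemma qpoch_add a q m k :
  qpoch a q (m + k) = qpoch a q m * qpoch (a * q ^+ m) q k.
Proof.
elim: k => [|k IHk]; first by rewrite addn0 qpoch0 mulr1.
by rewrite addnS !qpochS IHk exprD !mulrA.
Qed.

Lemma qpochSl a q m : qpoch a q m.+1 = (1 - a) * qpoch (a * q) q m.
Proof. by rewrite -add1n qpoch_add qpochS qpoch0 mul1r mulr1. Qed.

Lemma qpoch_neq0 a q m :
  (forall i, (i < m)%N -> 1 - a * q ^+ i != 0) -> qpoch a q m != 0.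
Proof. by move=> nz; apply/prodf_neq0 => i _; apply: nz. Qed.

Lemma qpoch_double a t m :
  qpoch a t (2 * m) = qpoch a (t ^+ 2) m * qpoch (a * t) (t ^+ 2) m.
Proof.
elim: m => [|m IHm]; first by rewrite muln0 !qpoch0 mulr1.
have e : (2 * m.+1 = (2 * m).+2)%N by lia.
by rewrite e !qpochS IHm (exprS t (2 * m)) (exprM t 2 m); ring.
Qed.

Lemma qpochVX0 p M K : p != 0 -> (M < K)%N -> qpoch (p ^- M) p K = 0.
Proof.
move=> p0 ltMK; apply/eqP/prodf_eq0; exists (Ordinal ltMK) => //=.
by rewrite mulVf ?expf_neq0 // subrr.
Qed.

(* Wilf-Zeilberger telescoping, as is [bailey_pair_telescope]: [w] stands for
   [p ^- M] and [w / p] for [p ^- M.+1], and the right-hand side vanishes as soon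
   as [M < K]. *)
Lemma qVandermonde_telescope a c p w K :
    a != 0 -> w != 0 -> p != 0 ->
    (forall i, 1 - p ^+ i.+1 != 0) -> (forall i, 1 - c * p ^+ i != 0) ->
  (1 - c / w) * (\sum_(j < K.+1) qpoch a p j * qpoch (w / p) p j
      / (qpoch p p j * qpoch c p j) * (c * p / (a * w)) ^+ j)
  - (1 - c / (a * w)) * (\sum_(j < K.+1) qpoch a p j * qpoch w p j
      / (qpoch p p j * qpoch c p j) * (c / (a * w)) ^+ j)
  = qpoch a p K.+1 * qpoch w p K / (qpoch p p K * qpoch c p K)
    * (c / (a * w)) ^+ K.+1.
Proof.
move=> a0 w0 p0 pnz cnz.
have pp0 k : qpoch p p k != 0 by apply: qpoch_neq0 => i _; rewrite -exprS.
have cp0 k : qpoch c p k != 0 by apply: qpoch_neq0.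
elim: K => [|K IHK].
  by rewrite !big_ord1 !qpochS !qpoch0 !expr0 !expr1; field; rewrite a0 w0 oner_neq0.
have step (x y s1 u s2 v : F) :
    x * (s1 + u) - y * (s2 + v) = (x * s1 - y * s2) + (x * u - y * v).
  by ring.
rewrite big_ord_recr [X in _ - _ * X]big_ord_recr step {step}IHK /=.
have := cnz K.+1; have := cnz K; have := pnz K.+1; have := pnz K.
rewrite (qpochSl (w / p)) divfK // [c * p / _]mulrAC.
set z := c / (a * w); rewrite (exprMn _ z p) !qpochS (exprS z K.+1) (exprS z K).
rewrite !(exprS p) {}/z.
move: (pp0 K) (cp0 K) => {}pp0 {}cp0.
move: (qpoch p p K) (qpoch c p K) pp0 cp0 => pK cK pK0 cK0.
move: (qpoch a p K) (qpoch w p K) (p ^+ K) ((c / (a * w)) ^+ K) => aK wK P zK n1 n2 n3 n4.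
field.
by rewrite ?a0 ?w0 ?p0 ?pK0 ?cK0 ?n1 ?n2 ?n3 ?n4.
Qed.

(** The q-Chu-Vandermonde sum, by induction on [M]. Every range reaching beyond [M] gives the same
    value, so both sums of the telescoping identity can share one range. *)
Lemma qVandermonde a c p M L :
    a != 0 -> p != 0 ->
    (forall i, 1 - p ^+ i.+1 != 0) -> (forall i, 1 - c * p ^+ i != 0) ->
    (M < L)%N ->
  \sum_(j < L) qpoch a p j * qpoch (p ^- M) p j
      / (qpoch p p j * qpoch c p j) * (c * p ^+ M / a) ^+ j
  = qpoch (c / a) p M / qpoch c p M.
Proof.
move=> a0 p0 pnz cnz.
have cp0 k : qpoch c p k != 0 by apply: qpoch_neq0.
elim: M L => [|M IHM] [|K] // ltMK.
  rewrite big_ord_recl big1 => [|j _].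
    by rewrite !qpoch0 !expr0 !mulr1 divr1 addr0.
  by rewrite [qpoch (p ^- 0) p _](qpochVX0 p0) // mulr0 !mul0r.
have := qVandermonde_telescope K a0 (invr_neq0 (expf_neq0 M p0)) p0 pnz cnz.
rewrite [qpoch (p ^- M) p K]qpochVX0 // mulr0 !mul0r => /subr0_eq.
have -> : c * p / (a * p ^- M) = c * p ^+ M.+1 / a by rewrite exprS invfM invrK; ring.
have -> : c / (a * p ^- M) = c * p ^+ M / a by rewrite invfM invrK; ring.
have -> : p ^- M / p = p ^- M.+1 by rewrite -invfM -exprSr.
rewrite invrK.
rewrite IHM; last exact: ltnW.
rewrite !qpochS => e; apply: (mulfI (cnz M)); rewrite e.
by rewrite [c / a * _]mulrAC; move: (cnz M) (cp0 M) => n1 n2; field; rewrite n1 n2.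
Qed.

(** * A Bailey pair relative to [b ^+ 2] in base [p = t ^+ 2] *)

Lemma bailey_pair_telescope b t p w K :
    p = t ^+ 2 -> w != 0 -> t != 0 ->
    (forall i, 1 - p ^+ i.+1 != 0) ->
    (forall i, 1 - b ^+ 2 * p / w * p ^+ i != 0) ->
  (1 - b * t / w) * (1 - b * p / w) *
    (\sum_(r < K.+1) qpoch (b ^+ 2) p r * qpoch (w / p) p r * (1 + b * p ^+ r)
      / (qpoch p p r * qpoch (b ^+ 2 * p / w * p) p r) * (t * p / w) ^+ r)
  - (1 - t / w) * (1 - b ^+ 2 * p / w) *
    (\sum_(r < K.+1) qpoch (b ^+ 2) p r * qpoch w p r * (1 + b * p ^+ r)
      / (qpoch p p r * qpoch (b ^+ 2 * p / w) p r) * (t / w) ^+ r)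
  = qpoch (b ^+ 2) p K.+1 * qpoch w p K
    / (qpoch p p K * qpoch (b ^+ 2 * p / w * p) p K)
    * (t / w) ^+ K.+1 * (1 - b * t * p ^+ K).
Proof.
move=> pE w0 t0 pnz enz; have p0 : p != 0 by rewrite pE expf_neq0.
have pp0 k : qpoch p p k != 0 by apply: qpoch_neq0 => i _; rewrite -exprS.
have ep0 k : qpoch (b ^+ 2 * p / w * p) p k != 0.
  by apply: qpoch_neq0 => i _; rewrite -mulrA -exprS.
elim: K => [|K IHK].
  rewrite !big_ord1 !qpochS !qpoch0 !expr0 !expr1 pE; field.
  by rewrite w0 oner_neq0.
have step (x y s1 u s2 v : F) :
    x * (s1 + u) - y * (s2 + v) = (x * s1 - y * s2) + (x * u - y * v).
  by ring.
rewrite big_ord_recr [X in _ - _ * X]big_ord_recr step {step}IHK /=.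
have := enz K.+1; have := enz 0; have := pnz K.
rewrite (qpochSl (w / p)) divfK // (qpochSl (b ^+ 2 * p / w)).
rewrite [t * p / _]mulrAC.
set z := t / w; rewrite (exprMn _ z p) !qpochS (exprS z K.+1) (exprS z K).
rewrite !(exprS p) {}/z.
move: (pp0 K) (ep0 K) => {}pp0 {}ep0.
move: (qpoch p p K) (qpoch (_ * p / w * p) p K) pp0 ep0 => pK eK pK0 eK0.
move: (qpoch (b ^+ 2) p K) (qpoch w p K) ((t / w) ^+ K) => aK wK zK.
have nz x : 1 - x / w != 0 -> w - x != 0.
  by apply: contraNneq => /subr0_eq <-; rewrite divff // subrr.
rewrite !(mulrAC _ w^-1) expr0 mulr1 pE; move: (_ ^+ K) => P n1 /nz n2 /nz n3.
rewrite pE in p0; field; rewrite w0 t0 pK0 eK0 n1 /=.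
rewrite [X in w - X](_ : _ = b ^+ 2 * t ^+ 2 * (t ^+ 2 * P)) ?n3 /=; last by ring.
by rewrite exprMn n2.
Qed.

(** The terminating very-well-poised 6phi5 sum at [a = b ^+ 2] with parameters [b] and [b * t]: the
    first cancels [1 - b * p ^+ r] and the factors of the second cancel each other. *)
Lemma bailey_pair_sum b t p n L :
    p = t ^+ 2 -> t != 0 ->
    (forall i, 1 - p ^+ i.+1 != 0) -> (forall i, 1 - b * t ^+ i.+1 != 0) ->
    (forall i, 1 - b ^+ 2 * p ^+ i.+1 != 0) -> (n < L)%N ->
  \sum_(r < L) qpoch (b ^+ 2) p r * qpoch (p ^- n) p r * (1 + b * p ^+ r)
      / (qpoch p p r * qpoch (b ^+ 2 * p ^+ n.+1) p r) * (t * p ^+ n) ^+ r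
  = (1 + b) * qpoch t p n * qpoch (b ^+ 2 * p) p n / qpoch (b * t) t (2 * n).
Proof.
move=> pE t0 pnz bnz anz; have p0 : p != 0 by rewrite pE expf_neq0.
have bt0 k : qpoch (b * t) t k != 0.
  by apply: qpoch_neq0 => i _; rewrite -mulrA -exprS.
elim: n L => [|n IHn] [|K] // ltnK.
  rewrite big_ord_recl big1 => [|j _].
    by rewrite muln0 !qpoch0 !expr0 !mulr1 mul1r divr1 addr0.
  by rewrite [qpoch (p ^- 0) p _](qpochVX0 p0) // mulr0 !mul0r.
have enz i : 1 - b ^+ 2 * p / p ^- n * p ^+ i != 0.
  by rewrite invrK -mulrA -exprD -mulrA -exprS.
have := bailey_pair_telescope K pE (invr_neq0 (expf_neq0 n p0)) t0 pnz enz.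
rewrite [qpoch (p ^- n) p K]qpochVX0 // mulr0 !mul0r => /subr0_eq.
have -> : p ^- n / p = p ^- n.+1 by rewrite -invfM -exprSr.
rewrite !invrK -![_ * p * p ^+ n]mulrA -!exprS -![_ * p ^+ n.+1 * p]mulrA -!exprSr.
rewrite IHn; last exact: ltnW.
have -> : (2 * n.+1 = (2 * n).+2)%N by lia.
rewrite !qpochS => e.
have tp k : t ^+ (2 * k) = p ^+ k by rewrite pE exprM.
have n1 := bnz (2 * n)%N.
have n3 := bt0 (2 * n)%N.
rewrite exprS tp mulrA in n1.
have n2 : 1 - b * p * p ^+ n != 0.
  by rewrite -tp pE -mulrA -exprD; apply: (bnz (2 * n).+1).
rewrite (exprS t (2 * n)) tp.
apply: (mulfI n1); apply: (mulfI n2); rewrite [RHS]mulrCA mulrA [_ * (1 - _)]mulrC.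
rewrite -[b * p * _]mulrA -exprS e; move: n1 n2 n3; rewrite pE (exprS _ n).
move: (qpoch (b * t) t (2 * n)) => u n1 n2 n3; field.
by rewrite n3 n1 [b * t * (t * _)]mulrA -[b * t * t]mulrA n2.
Qed.

(** Reversal of [qpoch (p ^- n) p r], with [n = r + m] to avoid a subtraction; the power of
    [t * p ^+ n] leaves the square exponent of [bailey_alpha]. *)
Lemma qpochVX p t r m : p = t ^+ 2 -> t != 0 ->
  qpoch (p ^- (r + m)) p r * qpoch p p m * (t * p ^+ (r + m)) ^+ r
  = (-1) ^+ r * t ^+ (r ^ 2) * qpoch p p (r + m).
Proof.
move=> pE t0; have p0 : p != 0 by rewrite pE expf_neq0.
elim: r => [|r IHr]; first by rewrite qpoch0 !expr0 !mul1r mulr1.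
rewrite addSn qpochSl -[p ^- (r + m).+1 * p](_ : p ^- (r + m) = _); last first.
  by rewrite exprS; field; rewrite expf_neq0.
have -> : (r.+1 ^ 2 = r ^ 2 + (2 * r).+1)%N by lia.
rewrite qpochS (exprD t); have -> : t ^+ (2 * r).+1 = t * p ^+ r by rewrite exprS exprM pE.
rewrite (exprS _ r) (exprS p (r + m)) [t * (p * _)]mulrCA (exprMn _ p).
set u := qpoch (p ^- (r + m)) p r in IHr *.
rewrite (_ : (-1) ^+ r.+1 * (t ^+ (r ^ 2) * (t * p ^+ r)) *
  (qpoch p p (r + m) * (1 - p * p ^+ (r + m))) = - (t * p ^+ r) * (1 - p * p ^+ (r + m))
  * ((-1) ^+ r * t ^+ (r ^ 2) * qpoch p p (r + m))); last by rewrite exprS; ring.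
rewrite -IHr; move: (_ ^+ r) => v; have := expf_neq0 (r + m) p0.
by move: (p ^+ (r + m)) => P P0; field; rewrite P0.
Qed.

(* Relative to [a = b ^+ 2] in base [t ^+ 2]; the usual factor [(1 + b)^-1] is
   moved to the other member of the pair. *)
Definition bailey_alpha b t r : F :=
  (-1) ^+ r * t ^+ (r ^ 2) * qpoch (b ^+ 2) (t ^+ 2) r * (1 + b * t ^+ 2 ^+ r)
  / qpoch (t ^+ 2) (t ^+ 2) r.

(** The defining relation of a Bailey pair, the right-hand side being the partner beta_n of
    [bailey_alpha]. Clearing [qpoch p p n] and [qpoch (b ^+ 2 * p) p n] reduces it to
    [bailey_pair_sum]. *)
Lemma bailey_pair b t p n :
    p = t ^+ 2 -> t != 0 ->
    (forall i, 1 - p ^+ i.+1 != 0) -> (forall i, 1 - b * t ^+ i.+1 != 0) ->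
    (forall i, 1 - b ^+ 2 * p ^+ i.+1 != 0) ->
  \sum_(r < n.+1) bailey_alpha b t r
      / (qpoch p p (n - r) * qpoch (b ^+ 2 * p) p (n + r))
  = (1 + b) * qpoch t p n / (qpoch p p n * qpoch (b * t) t (2 * n)).
Proof.
move=> pE t0 pnz bnz anz.
have pp0 k : qpoch p p k != 0 by apply: qpoch_neq0 => i _; rewrite -exprS.
have ap0 k m : qpoch (b ^+ 2 * p ^+ k.+1) p m != 0.
  by apply: qpoch_neq0 => i _; rewrite -mulrA -exprD addSn.
have n1 := pp0 n; have n2 := ap0 0 n.
apply: (mulIf n1); apply: (mulIf n2).
rewrite [RHS](_ : _ = (1 + b) * qpoch t p n * qpoch (b ^+ 2 * p) p n
                      / qpoch (b * t) t (2 * n)); last first.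
  by rewrite invfM; set v := (qpoch (b * t) t _)^-1; field.
rewrite -(bailey_pair_sum pE t0 pnz bnz anz (ltnSn n)) -mulrA mulr_suml.
apply: eq_bigr => r _; rewrite /bailey_alpha -pE.
have le_rn : (r <= n)%N by rewrite -ltnS.
have := qpochVX r (n - r) pE t0; rewrite subnKC // => e.
have -> : qpoch (b ^+ 2 * p) p (n + r)
    = qpoch (b ^+ 2 * p) p n * qpoch (b ^+ 2 * p ^+ n.+1) p r.
  by rewrite qpoch_add -mulrA -exprS.
have := ap0 n r; have m2 : qpoch (b ^+ 2 * p) p n != 0 := n2.
have := pp0 r; have := pp0 (n - r)%N; move: e.
set A := qpoch (b ^+ 2) p r; set u := qpoch (_ * p ^+ _) p r.
set w := qpoch (p ^- n) p r; set v := _ ^+ r => e m3 m4 m5.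
apply: (mulIf m3).
rewrite [RHS](_ : _ = w * qpoch p p (n - r) * v
   * (A * (1 + b * p ^+ r) / (qpoch p p r * u))); last by ring.
by rewrite e; field; rewrite m2 m3 m4 m5.
Qed.

(* The limiting case [e -> oo] of Watson's 8phi7 transformation, at the
   parameters [a = b ^+ 2], [c = b * t]. *)
Lemma watson_limit b t p rho N :
    p = t ^+ 2 -> t != 0 -> rho != 0 ->
    (forall i, 1 - p ^+ i.+1 != 0) -> (forall i, 1 - b * t ^+ i.+1 != 0) ->
    (forall i, 1 - b ^+ 2 * p ^+ i.+1 != 0) ->
    (forall i, (i < N)%N -> 1 - b ^+ 2 * p / rho * p ^+ i != 0) ->
  \sum_(j < N.+1) (1 + b) * qpoch rho p j * qpoch (p ^- N) p j
      * (b ^+ 2 * p ^+ N.+1 / rho) ^+ j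
      * (qpoch t p j / (qpoch p p j * qpoch (b * t) t (2 * j)))
  = \sum_(r < N.+1) bailey_alpha b t r * qpoch rho p r * qpoch (p ^- N) p r
      * (b ^+ 2 * p ^+ N.+1 / rho) ^+ r
      * qpoch (b ^+ 2 * p / rho) p N
      / (qpoch (b ^+ 2 * p / rho) p r * qpoch (b ^+ 2 * p) p (N + r)).
Proof.
move=> pE t0 rho0 pnz bnz anz rnz; have p0 : p != 0 by rewrite pE expf_neq0.
set z := b ^+ 2 * p ^+ N.+1 / rho.
pose G j r := qpoch rho p j * qpoch (p ^- N) p j * z ^+ j
  * (bailey_alpha b t r / (qpoch p p (j - r) * qpoch (b ^+ 2 * p) p (j + r))).
(* Bailey's lemma: each beta_j is expanded by its defining sum and the summations are
   interchanged. *)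
transitivity (\sum_(j < N.+1) \sum_(r < N.+1 | (r <= j)%N) G j r).
  apply: eq_bigr => j _; rewrite -mulr_sumr.
  have := bailey_pair j pE t0 pnz bnz anz.
  rewrite (big_ord_widen N.+1 (fun r => bailey_alpha b t r /
    (qpoch p p (j - r) * qpoch (b ^+ 2 * p) p (j + r))) (ltn_ord j)) => BP.
  rewrite [X in _ = _ * X]BP.
  by ring.
rewrite (exchange_big_dep xpredT) //=; apply: eq_bigr => r _.
have : (r <= N)%N by rewrite -ltnS.
move: (nat_of_ord r) => {}r le_rN.
(* Shifting [j] by [r] leaves a q-Chu-Vandermonde sum with parameters [rho * p ^+ r] and
   [b ^+ 2 * p ^+ (2 * r).+1], ending at [N - r]. *)
rewrite -(big_geq_mkord r N.+1 xpredT (fun j => G j r)) -{1}[r]add0n big_addn big_mkord.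
have cnz i : 1 - b ^+ 2 * p ^+ (2 * r).+1 * p ^+ i != 0.
  by rewrite -mulrA -exprD addSn.
have rhop0 : rho * p ^+ r != 0 by rewrite mulf_neq0 ?expf_neq0.
have ltNr : (N - r < N.+1 - r)%N by rewrite subSn.
have V := qVandermonde rhop0 p0 pnz cnz ltNr.
have apD k m : qpoch (b ^+ 2 * p) p (k + m)
    = qpoch (b ^+ 2 * p) p k * qpoch (b ^+ 2 * p ^+ k.+1) p m.
  by rewrite qpoch_add -mulrA -exprS.
have pN : p ^- N * p ^+ r = p ^- (N - r).
  by rewrite -{1}(subnK le_rN) exprD invfM -mulrA mulVf ?mulr1 ?expf_neq0.
have zE : b ^+ 2 * p ^+ (2 * r).+1 * p ^+ (N - r) / (rho * p ^+ r) = z.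
  have -> : p ^+ (2 * r).+1 = p ^+ r.+1 * p ^+ r by rewrite -exprD addSn mul2n addnn.
  rewrite /z -{2}(subnKC le_rN) -addSn exprD; field.
  by rewrite rho0 expf_neq0.
have aE : b ^+ 2 * p ^+ (2 * r).+1 / (rho * p ^+ r) = b ^+ 2 * p / rho * p ^+ r.
  have -> : p ^+ (2 * r).+1 = p * (p ^+ r * p ^+ r) by rewrite -exprD -exprS mul2n addnn.
  by field; rewrite rho0 expf_neq0.
rewrite zE aE in V.
transitivity (qpoch rho p r * qpoch (p ^- N) p r * z ^+ r * bailey_alpha b t r
  / qpoch (b ^+ 2 * p) p (2 * r)
  * (qpoch (b ^+ 2 * p / rho * p ^+ r) p (N - r) /
       qpoch (b ^+ 2 * p ^+ (2 * r).+1) p (N - r))).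
  rewrite -V mulr_sumr; apply: eq_bigr => j _; rewrite /G addnK.
  have sh x : qpoch x p (j + r) = qpoch x p r * qpoch (x * p ^+ r) p j.
    by rewrite addnC qpoch_add.
  have -> : (j + r + r = 2 * r + j)%N by lia.
  rewrite apD !sh pN exprD !invfM; ring.
have -> : (N + r = 2 * r + (N - r))%N by lia.
have -> : qpoch (b ^+ 2 * p / rho) p N = qpoch (b ^+ 2 * p / rho) p r
    * qpoch (b ^+ 2 * p / rho * p ^+ r) p (N - r).
  by rewrite -qpoch_add subnKC.
have : qpoch (b ^+ 2 * p / rho) p r != 0.
  by apply: qpoch_neq0 => i lt_ir; apply: rnz; apply: leq_trans le_rN.
rewrite apD; move: (qpoch (b ^+ 2 * p / rho) p r) => u u0.
rewrite !invfM; set v1 := (qpoch _ p (2 * r))^-1; set v2 := (qpoch _ p (N - r))^-1.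
by field.
Qed.

End QPochhammer.

(** * The deformed sums *)

Section Deformation.
Variable F : fieldType.
Implicit Types q x : F.

Definition cq_deformed q d x k : F :=
  (-1) ^+ k
  * ((1 + q ^+ (2 * d * k + 1))
       * (qpoch (q ^+ 2) (q ^+ (2 * d)) k * qpoch (x * q ^+ 2) (q ^+ (2 * d)) k
          * qpoch (q ^+ 2 / x) (q ^+ (2 * d)) k)
     / ((1 + q) * (qpoch (q ^+ (2 * d)) (q ^+ (2 * d)) k
                   * qpoch (x * q ^+ (2 * d)) (q ^+ (2 * d)) k
                   * qpoch (q ^+ (2 * d) / x) (q ^+ (2 * d)) k)))
  * q ^+ (d * k ^ 2 + 2 * k * (d - 1)).

Definition rhs_term_deformed q d x k : F :=
  qpoch (x * q ^+ 2) (q ^+ (2 * d)) k * qpoch (q ^+ 2 / x) (q ^+ (2 * d)) k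
  * qpoch (q ^+ d) (q ^+ (2 * d)) k * q ^+ (2 * (d - 1) * k)
  / qpochs [:: q ^+ (d + 1); q ^+ (2 * d); q ^+ (2 * d + 1)] (q ^+ (2 * d)) k.

Lemma cq_deformed1 q d k : cq_deformed q d 1 k = cq q d k.
Proof. by rewrite /cq_deformed /cq !mul1r !divr1 !exprSr !expr0 !mul1r. Qed.

(** Factor by factor, [1 - q ^+ e = - q ^+ e * (1 - q ^- e)]; the exponents [e = 2 * (d * j + 1)],
    [j < N], add up to [N * (d * N + 2 - d)]. *)
Lemma qpoch_rev q d N : q != 0 -> (0 < d)%N ->
  qpoch (q ^+ (2 * d) / q ^+ (2 * (d * N + 1))) (q ^+ (2 * d)) N
    * ((-1) ^+ N * q ^+ (N * (d * N + 2 - d)))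
  = qpoch (q ^+ 2) (q ^+ (2 * d)) N.
Proof.
move=> q0 d0; elim: N => [|N IHN]; first by rewrite !qpoch0 !expr0 !mulr1.
rewrite qpochSl qpochS -IHN.
have -> : q ^+ (2 * d) / q ^+ (2 * (d * N.+1 + 1)) = (q ^+ (2 * (d * N + 1)))^-1.
  have -> : (2 * (d * N.+1 + 1) = 2 * d + 2 * (d * N + 1))%N by lia.
  by rewrite exprD; field; rewrite !expf_neq0.
rewrite [_^-1 * _]mulrC.
(* At [N = 0] the subtraction may truncate, but the factor [N] kills the result. *)
have -> : (N.+1 * (d * N.+1 + 2 - d) = N * (d * N + 2 - d) + 2 * (d * N + 1))%N.
  by case: N {IHN} => [|N]; nia.
rewrite -[q ^+ 2 * _](_ : q ^+ (2 * (d * N + 1)) = _); last first.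
  by rewrite -exprM -exprD; congr (_ ^+ _); lia.
rewrite exprS exprD; have := expf_neq0 (2 * (d * N + 1))%N q0.
by move: (q ^+ (2 * (d * N + 1))) => y y0; field.
Qed.

Lemma qintE q m : 1 - q != 0 -> qint q m = (1 - q ^+ m) / (1 - q).
Proof.
move=> q1; apply: (mulIf q1); rewrite divfK // mulrC /qint.
by rewrite -[1 - q]opprB -[1 - q ^+ m]opprB subrX1 mulNr.
Qed.

Lemma oneD_neq0 q : 1 - q ^+ 2 != 0 -> 1 + q != 0.
Proof.
by rewrite (_ : 1 - q ^+ 2 = (1 - q) * (1 + q)) ?mulf_eq0 => [/norP[]|]; last ring.
Qed.

(** This is [watson_limit] at [b = q], [t = q ^+ d], [rho = x * q ^+ 2]. The choice of [x] makes
    [q ^+ 2 / x] equal to [p ^- N], so that a deformed numerator factor terminates the sum. *)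
Lemma deformed_identity q d N n :
    q != 0 -> (forall m, 1 - q ^+ m.+1 != 0) -> (0 < d)%N -> n = (d * N + 1)%N ->
  \sum_(k < N.+1) cq_deformed q d (q ^+ (2 * n)) k
  = (-1) ^+ N * qint (q ^+ 2) n * q ^+ (N * (n + 1 - d))
    * \sum_(k < N.+1) rhs_term_deformed q d (q ^+ (2 * n)) k.
Proof.
move=> q0 qnz d0 nE; set x := q ^+ (2 * n); pose p := q ^+ (2 * d).
have x0 : x != 0 by rewrite expf_neq0.
have p0 : p != 0 by rewrite expf_neq0.
have q1p0 : 1 + q != 0 := oneD_neq0 (qnz 1%N).
have pos m : (0 < m)%N -> 1 - q ^+ m != 0 by case: m.
have pE : p = (q ^+ d) ^+ 2 by rewrite -exprM mulnC.
have pX i : p ^+ i = q ^+ (2 * d * i) by rewrite -exprM.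
have pnz i : 1 - p ^+ i.+1 != 0 by rewrite pX; apply: pos; lia.
have bnz i : 1 - q * (q ^+ d) ^+ i.+1 != 0.
  by rewrite -exprM -exprS; apply: pos.
have anz i : 1 - q ^+ 2 * p ^+ i.+1 != 0.
  by rewrite pX -exprD; apply: pos.
have rho0 : x * q ^+ 2 != 0 by rewrite mulf_neq0 ?expf_neq0.
have aE : q ^+ 2 * p / (x * q ^+ 2) = p / x by field; rewrite x0.
have rnz i : (i < N)%N -> 1 - q ^+ 2 * p / (x * q ^+ 2) * p ^+ i != 0.
  move=> ltiN; rewrite aE mulrAC -exprS pX.
  have -> : x = q ^+ (2 * d * i.+1) * q ^+ (2 * n - 2 * d * i.+1).
    by rewrite -exprD subnKC //; nia.
  have y0 := expf_neq0 (2 * n - 2 * d * i.+1)%N q0.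
  rewrite invfM mulrA divff ?expf_neq0 // mul1r.
  have : 1 - q ^+ (2 * n - 2 * d * i.+1) != 0 by apply: pos; nia.
  by apply: contraNneq => /subr0_eq e; rewrite -[q ^+ _]invrK -e invr1 subrr.
have := watson_limit pE (expf_neq0 d q0) rho0 pnz bnz anz rnz.
have wE : p ^- N = q ^+ 2 / x.
  rewrite pX /x nE (_ : 2 * (d * N + 1) = 2 * d * N + 2)%N; last by lia.
  by rewrite exprD; field; rewrite !expf_neq0 ?q0.
have zE : q ^+ 2 * p ^+ N.+1 / (x * q ^+ 2) = q ^+ (2 * (d - 1)).
  apply: (mulIf rho0); rewrite divfK // pX /x -!exprD; congr (_ ^+ _); nia.
rewrite aE wE zE => W.
have pxN0 : qpoch (p / x) p N != 0.
  by apply: qpoch_neq0 => i ltiN; rewrite -aE rnz.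
have apN0 k : qpoch (q ^+ 2 * p) p k != 0.
  by apply: qpoch_neq0 => i _; rewrite -mulrA -exprS.
(* Since [q ^+ 2 * p ^+ N = x], both [(1 - q ^+ 2) * qpoch (q ^+ 2 * p) p N] and
   [qpoch (q ^+ 2) p N * (1 - x)] are [qpoch (q ^+ 2) p N.+1]; [qpoch_rev] does the rest. *)
have prefE : (-1) ^+ N * qint (q ^+ 2) n * q ^+ (N * (n + 1 - d))
    = qpoch (q ^+ 2 * p) p N / qpoch (p / x) p N.
  apply: (mulIf pxN0); rewrite divfK //.
  have := qpoch_rev N q0 d0; rewrite -nE -/x -/p => e.
  rewrite qintE; last exact: qnz 1%N.
  apply: (mulIf (qnz 1%N)); rewrite [RHS]mulrC -qpochSl qpochS -e.
  rewrite -[q ^+ 2 * p ^+ N](_ : x = _); last first.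
    by rewrite pX -exprD /x nE; congr (_ ^+ _); lia.
  rewrite -exprM -/x; have -> : (d * N + 2 = n + 1)%N by lia.
  by field; rewrite (qnz 1%N).
rewrite prefE; pose C := qpoch (q ^+ 2 * p) p N / qpoch (p / x) p N / (1 + q).
have pxk0 k : (k <= N)%N -> qpoch (p / x) p k != 0.
  move=> lekN; apply: qpoch_neq0 => i ltik; rewrite -aE rnz //.
  exact: leq_trans lekN.
have apE k : qpoch (q ^+ 2 * p) p (N + k) = qpoch (q ^+ 2 * p) p N * qpoch (x * p) p k.
  rewrite qpoch_add; congr (_ * qpoch _ p k).
  by rewrite -mulrA mulrCA pX -exprD mulrC /x nE; congr (q ^+ _ * _); lia.
have xp0 k : qpoch (x * p) p k != 0.
  by have := apN0 (N + k)%N; rewrite apE mulf_eq0 => /norP[].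
have pp0 k : qpoch p p k != 0 by apply: qpoch_neq0 => i _; rewrite -exprS.
transitivity (C * \sum_(r < N.+1) bailey_alpha q (q ^+ d) r * qpoch (x * q ^+ 2) p r
     * qpoch (q ^+ 2 / x) p r * q ^+ (2 * (d - 1)) ^+ r * qpoch (p / x) p N
     / (qpoch (p / x) p r * qpoch (q ^+ 2 * p) p (N + r))).
  rewrite mulr_sumr; apply: eq_bigr => -[r ltrN] _ /=.
  rewrite apE /cq_deformed /bailey_alpha /C -pE pX addn1 exprS -/p.
  have -> : q ^+ (d * r ^ 2 + 2 * r * (d - 1))
      = q ^+ d ^+ (r ^ 2) * q ^+ (2 * (d - 1)) ^+ r.
    by rewrite -!exprM -exprD; congr (_ ^+ _); lia.
  move: (pxk0 r ltrN) (pxN0) (apN0 N) (xp0 r) (pp0 r) => m1 m2 m3 m4 m5.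
  by field; rewrite q1p0 m1 m2 m3 m4 m5.
rewrite -W !mulr_sumr; apply: eq_bigr => -[r ltrN] _ /=.
rewrite /rhs_term_deformed /qpochs !big_cons big_nil mulr1 qpoch_double -pE /C.
have -> : q * q ^+ d * q ^+ d = q * p by rewrite pE; ring.
have -> : q ^+ (2 * d + 1) = q * p by rewrite addn1 exprS.
have -> : q ^+ (d + 1) = q * q ^+ d by rewrite addn1 exprS.
rewrite -/p (exprM q (2 * (d - 1)) r) !invfM.
set u1 := (qpoch p p r)^-1; set u2 := (qpoch (q * p) p r)^-1.
set u3 := (qpoch (q * q ^+ d) p r)^-1; set u4 := (qpoch (p / x) p N)^-1.
by field; rewrite q1p0.
Qed.

End Deformation.

(** * Filtered local rings *)

(** [V 0] models a local ring in [L] and [V k] the k-th power of its maximal ideal. The abstraction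
    lets one argument serve both Phi_n(q) and Phi_n(-q). *)
Record filtration (L : fieldType) (V : nat -> L -> Prop) : Prop := Filtration {
  filtration_zero : forall k, V k 0;
  filtration_one : V 0 1;
  filtrationB : forall k x y, V k x -> V k y -> V k (x - y);
  filtrationM : forall k l x y, V k x -> V l y -> V (k + l)%N (x * y);
  filtrationS : forall k x, V k.+1 x -> V k x
}.

Section Filtration.
Variables (L : fieldType) (V : nat -> L -> Prop) (filtV : filtration V).
Implicit Types (a c p q x y : L) (k l m : nat).

Definition local_unit x : Prop := [/\ x != 0, V 0 x & V 0 x^-1].

Let V0 k : V k 0 := filtration_zero filtV k.
Let V1 : V 0 1 := filtration_one filtV.
Let VB := filtrationB filtV.

Lemma filtrationN k x : V k x -> V k (- x).
Proof. by rewrite -sub0r; apply: VB. Qed.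

Lemma filtrationD k x y : V k x -> V k y -> V k (x + y).
Proof. by move=> vx /filtrationN vy; rewrite -[y]opprK; apply: VB. Qed.

Lemma filtrationMl k x y : V 0 x -> V k y -> V k (x * y).
Proof. exact: filtrationM. Qed.

Lemma filtrationMr k x y : V k x -> V 0 y -> V k (x * y).
Proof. by move=> vx vy; rewrite mulrC; apply: filtrationMl. Qed.

Lemma filtrationW k l x : (l <= k)%N -> V k x -> V l x.
Proof.
move=> /subnK <-; elim: (k - l)%N => // m IHm /(filtrationS filtV); exact: IHm.
Qed.

Lemma filtrationX k m x : V k x -> V (k * m)%N (x ^+ m).
Proof.
move=> vx; elim: m => [|m IHm]; first by rewrite muln0.
by rewrite mulnS exprS; apply: filtrationM.
Qed.

Lemma filtration_sum k (I : Type) (r : seq I) (Q : pred I) (f : I -> L) :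
  (forall i, Q i -> V k (f i)) -> V k (\sum_(i <- r | Q i) f i).
Proof. by move=> vf; elim/big_ind: _ => //; apply: filtrationD. Qed.

Lemma filtration_sign m x k : V k x -> V k ((-1) ^+ m * x).
Proof.
by move=> vx; rewrite -signr_odd; case: odd; rewrite ?expr0 ?expr1 ?mulN1r ?mul1r //;
  apply: filtrationN.
Qed.

Lemma congruenceM k x x' y y' :
    V 0 x' -> V 0 y -> V k (x - x') -> V k (y - y') -> V k (x * y - x' * y').
Proof.
move=> vx' vy vx vyy; rewrite (_ : _ - _ = (x - x') * y + x' * (y - y')); last by ring.
by apply: filtrationD; [apply: filtrationMr | apply: filtrationMl].
Qed.

Lemma congruenceV k x y :
  local_unit x -> local_unit y -> V k (x - y) -> V k (x^-1 - y^-1).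
Proof.
move=> [x0 _ vx] [y0 _ vy] vxy.
rewrite (_ : _ - _ = - (x - y) * (x^-1 * y^-1)); last by field; rewrite x0 y0.
apply: filtrationMr; [exact: filtrationN | exact: filtrationMl].
Qed.

Lemma local_unitM x y : local_unit x -> local_unit y -> local_unit (x * y).
Proof.
by move=> [? ? ?] [? ? ?]; split; rewrite ?mulf_neq0 ?invfM //; apply: filtrationMl.
Qed.

Lemma local_unitV x : local_unit x -> local_unit x^-1.
Proof. by case; split; rewrite ?invr_eq0 ?invrK. Qed.

Lemma local_unit1 : local_unit 1.
Proof. by split; rewrite ?oner_neq0 ?invr1. Qed.

Lemma local_unitX x m : local_unit x -> local_unit (x ^+ m).
Proof.
move=> ux; elim: m => [|m IHm]; first exact: local_unit1.
by rewrite exprS; apply: local_unitM.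
Qed.

Lemma local_unitN x : local_unit x -> local_unit (- x).
Proof. by case=> ? ? ?; split; rewrite ?oppr_eq0 ?invrN //; apply: filtrationN. Qed.

Lemma local_unit_qpoch a q m :
  (forall i, (i < m)%N -> local_unit (1 - a * q ^+ i)) -> local_unit (qpoch a q m).
Proof.
elim: m => [|m IHm] ua; first by rewrite qpoch0; apply: local_unit1.
rewrite qpochS; apply: local_unitM; last exact: ua.
by apply: IHm => i ltim; apply: ua; apply: ltnW.
Qed.

Lemma filtration_qpoch a q m : V 0 a -> V 0 q -> V 0 (qpoch a q m).
Proof.
move=> va vq; elim: m => [|m IHm]; first by rewrite qpoch0.
rewrite qpochS; apply: filtrationMl => //; apply: VB => //.
exact: filtrationMl (filtrationX m vq).
Qed.

(* [(1 - x * e) * (1 - e / x) - (1 - e) ^+ 2 = - e * (1 - x) ^+ 2 / x]: the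
   deformation only matters to the second order at [x = 1]. *)
Lemma qpoch_deformation c p x m :
    V 0 c -> V 0 p -> local_unit x -> V 1 (1 - x) ->
  V 2 (qpoch (x * c) p m * qpoch (c / x) p m - qpoch (1 * c) p m * qpoch (c / 1) p m).
Proof.
move=> vc vp [x0 vx vxV] vx1; elim: m => [|m IHm].
  by rewrite !qpoch0 subrr.
rewrite !qpochS ![_ * (1 - _) * (qpoch _ _ _ * _)]mulrACA.
have vpm : V 0 (p ^+ m) := filtrationX m vp.
have vce : V 0 (c * p ^+ m) := filtrationMl vc vpm.
apply: congruenceM => //.
- by apply: filtrationMl; apply: filtration_qpoch; rewrite ?mul1r ?divr1.
- by apply: filtrationMl; apply: VB => //; apply: filtrationMr => //; apply: filtrationMl.
rewrite [X in V 2 X](_ : _ = - (c * p ^+ m) * ((1 - x) ^+ 2 * x^-1)); last first.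
  by field; rewrite x0 oner_neq0.
apply: filtrationMl; first exact: filtrationN.
by apply: filtrationMr => //; apply: (filtrationX 2 vx1).
Qed.

End Filtration.

(** * The congruences in a filtered field *)

Section Congruence.
Variables (L : fieldType) (V : nat -> L -> Prop) (filtV : filtration V).
Variables (q : L) (d N n : nat).
Hypotheses (d_ge3 : (3 <= d)%N) (N_gt0 : (0 < N)%N).
Hypotheses (n_odd : odd n) (nE : n = (d * N + 1)%N).
(** What is common to Phi_n(q) and Phi_n(-q), modulo which [q] is a root of unity of order [n] and
    [2 * n] respectively. *)
Hypothesis qX_neq1 : forall m, 1 - q ^+ m.+1 != 0.
Hypothesis q_unit : local_unit V q.
Hypothesis qX_unit : forall m, ~~ (n %| m)%N -> local_unit V (1 - q ^+ m).
Hypothesis q2n_vanish : V 1 (1 - q ^+ (2 * n)).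

Let x := q ^+ (2 * n).
Let p := q ^+ (2 * d).

Let V1 : V 0 1 := filtration_one filtV.
Let unitV y : local_unit V y -> V 0 y. Proof. by case. Qed.
Let unitVV y : local_unit V y -> V 0 y^-1. Proof. by case. Qed.
Let vq m : V 0 (q ^+ m). Proof. exact/unitV/(local_unitX filtV). Qed.
Let qX1V m : V 0 (1 - q ^+ m). Proof. exact: filtrationB. Qed.
Let vp : V 0 p. Proof. exact: vq. Qed.
Let x_unit : local_unit V x. Proof. exact: local_unitX. Qed.
Let q0 : q != 0. Proof. by case: q_unit. Qed.

(** * Units among the denominators *)

Let coprime_n2d : coprime n (2 * d).
Proof.
rewrite coprimeMr coprimen2 n_odd /= nE.
by rewrite coprime_sym /coprime mulnC gcdnMDl gcdn1.
Qed.

Let pX i : p ^+ i = q ^+ (2 * d * i). Proof. by rewrite -exprM. Qed.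

Let dvd_2d i : (0 < i < n)%N -> ~~ (n %| 2 * d * i)%N.
Proof.
by case/andP=> i0 ltin; rewrite Gauss_dvdr // gtnNdvd.
Qed.

Lemma local_unit_pp k : (k < n)%N -> local_unit V (qpoch p p k).
Proof.
move=> ltkn; apply: local_unit_qpoch => // i ltik; rewrite -exprS pX.
by apply/qX_unit/dvd_2d; rewrite /= (leq_ltn_trans _ ltkn).
Qed.

Lemma local_unit_xp k : (k < n)%N -> local_unit V (qpoch (x * p) p k).
Proof.
move=> ltkn; apply: local_unit_qpoch => // i ltik; rewrite -mulrA -exprS pX -exprD.
apply: qX_unit; rewrite dvdn_addr; last exact: dvdn_mull.
by apply: dvd_2d; rewrite /= (leq_ltn_trans _ ltkn).
Qed.

Lemma local_unit_px k : (k <= N)%N -> local_unit V (qpoch (p / x) p k).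
Proof.
move=> lekN; apply: local_unit_qpoch => // i ltik; rewrite mulrAC -exprS pX.
(* The factor is [1 - q ^- e] with [e = 2 * n - 2 * d * i.+1], that is, a unit times [1 - q ^+ e];
   [k <= N] keeps the subtraction exact. *)
have lt2n : (2 * d * i.+1 <= 2 * n)%N by nia.
have -> : x = q ^+ (2 * d * i.+1) * q ^+ (2 * n - 2 * d * i.+1) by rewrite -exprD subnKC.
have y0 := expf_neq0 (2 * n - 2 * d * i.+1)%N q0.
rewrite [X in local_unit _ X](_ : _ =
    - (1 - q ^+ (2 * n - 2 * d * i.+1)) * (q ^+ (2 * n - 2 * d * i.+1))^-1); last first.
  by rewrite invfM mulrA divff ?expf_neq0 // mul1r opprB mulrBl divff // mul1r.
apply: local_unitM => //; last exact/(local_unitV)/(local_unitX filtV).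
apply/(local_unitN filtV)/qX_unit; rewrite dvdn_subr //; last exact: dvdn_mull.
by apply: dvd_2d; nia.
Qed.

Let n_gt3 : (3 < n)%N. Proof. nia. Qed.

Let q2_unit : local_unit V (1 - q ^+ 2).
Proof. by apply: qX_unit; rewrite gtnNdvd //; lia. Qed.

Let q1p_unit : local_unit V (1 + q).
Proof.
have q10 : 1 - q != 0 := qX_neq1 0.
have -> : 1 + q = (1 - q ^+ 2) * (1 - q ^+ 1)^-1 by rewrite expr1; field.
apply: local_unitM => //; apply/local_unitV/qX_unit; rewrite gtnNdvd //; lia.
Qed.

(** * The terms [cq] and the triple sum *)

Lemma filtration_cq k : (k < n)%N -> V 0 (cq q d k).
Proof.
move=> ltkn; apply: (filtrationMr filtV) (vq _); apply: filtration_sign => //.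
rewrite -/p; apply: (filtrationMl filtV).
  apply: (filtrationMl filtV); first exact: filtrationD.
  by apply: (filtrationX filtV 3 (k := 0)); apply: filtration_qpoch.
apply: unitVV; apply: (local_unitM filtV) => //; apply: (local_unitX filtV).
exact: local_unit_pp.
Qed.

(** Beyond [N] the cubed numerator product contains [1 - q ^+ 2 * p ^+ N = 1 - q ^+ (2 * n)]. *)
Lemma filtration3_cq k : (N < k < n)%N -> V 3 (cq q d k).
Proof.
case/andP=> ltNk ltkn; apply: (filtrationMr filtV) (vq _); apply: filtration_sign => //.
rewrite -/p; apply: (filtrationMr filtV); last first.
  apply: unitVV; apply: (local_unitM filtV) => //; apply: (local_unitX filtV).
  exact: local_unit_pp.
apply: (filtrationMl filtV); first exact: filtrationD.
apply: (filtrationX filtV 3 (k := 1)).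
rewrite -(subnKC ltNk) qpoch_add qpochS; apply: (filtrationMr filtV).
  apply: (filtrationMl filtV); first exact: filtration_qpoch.
  by rewrite pX -exprD (_ : 2 + _ = 2 * n)%N //; lia.
by apply: filtration_qpoch => //; apply: (filtrationMl filtV) => //; rewrite pX.
Qed.

(** The deformed factors form two pairs, each agreeing to second order with its value at [x = 1];
    for [k <= N] the denominator pair is a unit. *)
Lemma cq_congruence k : (k <= N)%N -> V 2 (cq_deformed q d x k - cq q d k).
Proof.
move=> lekN; have ltkn : (k < n)%N by nia.
pose u := (-1) ^+ k * ((1 + q ^+ (2 * d * k + 1)) * qpoch (q ^+ 2) p k)
  * ((1 + q) * qpoch p p k)^-1 * q ^+ (d * k ^ 2 + 2 * k * (d - 1)).
have cE y : cq_deformed q d y k = u * ((qpoch (y * q ^+ 2) p k * qpoch (q ^+ 2 / y) p k)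
      * (qpoch (y * p) p k * qpoch (p / y) p k)^-1).
  rewrite /cq_deformed -/p /u !invfM; set v1 := (1 + q)^-1; set v2 := (qpoch p p k)^-1.
  set v3 := (qpoch (y * p) p k)^-1; set v4 := (qpoch (p / y) p k)^-1; ring.
rewrite -cq_deformed1 !cE -mulrBr; apply: (filtrationMl filtV).
  apply: (filtrationMr filtV) (vq _); rewrite -mulrA; apply: filtration_sign => //.
  apply: (filtrationMl filtV).
    by apply: (filtrationMl filtV); [exact: filtrationD | exact: filtration_qpoch].
  by apply: unitVV; apply: (local_unitM filtV) => //; apply: local_unit_pp.
apply: congruenceM => //.
- by rewrite mul1r divr1; apply: (filtrationMl filtV); apply: filtration_qpoch.
- by apply: unitVV; apply: (local_unitM filtV); [apply: local_unit_xp | apply: local_unit_px].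
- exact: qpoch_deformation.
apply: congruenceV => //.
- by apply: (local_unitM filtV); [apply: local_unit_xp | apply: local_unit_px].
- by rewrite mul1r divr1; apply: (local_unitM filtV); apply: local_unit_pp.
exact: qpoch_deformation.
Qed.

Definition lhs_sum : L := \sum_(k < N.+1) cq q d k.
Definition triple_sum : L :=
  \sum_(i < n) \sum_(j < n) \sum_(s < n | (i + j + s <= n - 1)%N)
    cq q d i * cq q d j * cq q d s.

Lemma filtration_lhs_sum : V 0 lhs_sum.
Proof. apply: filtration_sum => // k _; apply: filtration_cq; have := ltn_ord k; nia. Qed.

Lemma triple_sum_congruence : V 3 (triple_sum - lhs_sum ^+ 3).
Proof.
(* Extension by zero expands the cube over the same box of indices as the triple sum. *)
pose c k := if (k <= N)%N then cq q d k else 0.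
have SE : lhs_sum = \sum_(i < n) c i.
  have leNn : (N.+1 <= n)%N by nia.
  rewrite /lhs_sum (big_ord_widen n (fun k => cq q d k)) // big_mkcond.
  by apply: eq_bigr => i _; rewrite ltnS.
have -> : lhs_sum ^+ 3 = \sum_(i < n) \sum_(j < n) \sum_(s < n) c i * c j * c s.
  rewrite SE exprS expr2 mulrA !mulr_suml; apply: eq_bigr => i _.
  rewrite [c i * _]mulr_sumr mulr_suml; apply: eq_bigr => j _.
  by rewrite mulr_sumr.
rewrite /triple_sum -sumrB; apply: filtration_sum => // i _.
rewrite -sumrB; apply: filtration_sum => // j _.
rewrite big_mkcond -sumrB; apply: filtration_sum => // s _; rewrite /c.
have [[lti ltj] lts] := (ltn_ord i, ltn_ord j, ltn_ord s).
have [leiN | ltiN] := leqP i N; last first.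
  rewrite !mul0r subr0; case: ifP => _; last exact: filtration_zero.
  do 2!(apply: (filtrationMr filtV); last exact: filtration_cq).
  by apply: filtration3_cq; rewrite ltiN.
have [lejN | ltjN] := leqP j N; last first.
  rewrite mulr0 mul0r subr0; case: ifP => _; last exact: filtration_zero.
  apply: (filtrationMr filtV); last exact: filtration_cq.
  apply: (filtrationMl filtV); first exact: filtration_cq.
  by apply: filtration3_cq; rewrite ltjN.
have [lesN | ltsN] := leqP s N; last first.
  rewrite mulr0 subr0; case: ifP => _; last exact: filtration_zero.
  apply: (filtrationMl filtV); last by apply: filtration3_cq; rewrite ltsN.
  by apply: (filtrationMl filtV); apply: filtration_cq.
(* With all indices at most [N], the bound [3 * N <= d * N = n - 1] makes the summation condition
   automatic. *)
rewrite ifT ?subrr; last nia.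
exact: filtration_zero.
Qed.

(** * The right-hand side *)

Definition rhs_prefactor : L := (-1) ^+ N * qint (q ^+ 2) n * q ^+ (N * (n + 1 - d)).
Definition rhs_sum : L := rhs_prefactor * \sum_(k < N.+1) rhs_term_deformed q d 1 k.

(** The part free of the deformation, with [qint (q ^+ 2) n] grouped with the two denominators that
    may fail to be units. *)
Let rhs_coef k : L := (-1) ^+ N * (q ^+ (N * (n + 1 - d)) * (qpoch (q ^+ d) p k
  * q ^+ (2 * (d - 1) * k) * (qpoch p p k)^-1
  * (qint (q ^+ 2) n * (qpoch (q ^+ (d + 1)) p k * qpoch (q ^+ (2 * d + 1)) p k)^-1))).

Let rhs_coefE y k : rhs_prefactor * rhs_term_deformed q d y k
  = rhs_coef k * (qpoch (y * q ^+ 2) p k * qpoch (q ^+ 2 / y) p k).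
Proof.
rewrite /rhs_prefactor /rhs_term_deformed /rhs_coef /qpochs !big_cons big_nil -/p mulr1.
rewrite !invfM; set v1 := (qpoch _ p k)^-1; set v2 := (qpoch p p k)^-1.
set v3 := (qpoch (q ^+ (2 * d + 1)) p k)^-1; ring.
Qed.

(** All other factors lie in [V 0]. The case [m = 0] serves the congruence in [V 2], and [m = 1] the
    extra vanishing at Phi_n(-q). *)
Lemma filtration_rhs_coef m k :
    V m (qint (q ^+ 2) n
         * (qpoch (q ^+ (d + 1)) p k * qpoch (q ^+ (2 * d + 1)) p k)^-1) ->
    (k <= N)%N ->
  V m (rhs_coef k).
Proof.
move=> vm lekN; apply: filtration_sign => //; apply: (filtrationMl filtV) => //.
apply: (filtrationMl filtV) => //; apply: (filtrationMl filtV); last first.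
  by apply/unitVV/local_unit_pp; nia.
by apply: (filtrationMr filtV) => //; apply: filtration_qpoch.
Qed.

(* The denominator has a single non-unit factor, [1 - q ^+ n]. *)
Lemma local_unit_denominator K : (K <= 2 * N)%N ->
  local_unit V (qpoch (q ^+ (d + 1)) (q ^+ d) K
                * (if (K < N)%N then 1 else 1 - q ^+ n)^-1).
Proof.
have step m : q ^+ (d + 1) * q ^+ d ^+ m = q ^+ (d * m.+1 + 1).
  by rewrite -exprM -exprD; congr (_ ^+ _); lia.
have nz : 1 - q ^+ n != 0 by rewrite nE addn1.
elim: K => [|K IHK] leK2N.
  by rewrite N_gt0 qpoch0 divr1; apply: local_unit1.
have {}IHK := IHK (ltnW leK2N); rewrite qpochS step mulrAC.
case: (ltngtP K.+1 N) IHK => [ltKN | ltNK | eqKN].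
- move=> uK; apply: (local_unitM filtV) => //.
  by apply: qX_unit; rewrite gtnNdvd //; nia.
- move=> uK; apply: (local_unitM filtV) => //.
  (* The excess over [n] is positive and at most [d * N = n - 1], so [n] cannot divide it. *)
  apply: qX_unit; rewrite (_ : d * K.+1 + 1 = n + d * (K.+1 - N))%N; last by nia.
  by rewrite dvdn_addr // gtnNdvd //; nia.
by rewrite eqKN -nE divr1 -mulrA mulVf // mulr1.
Qed.

(** The two products merge into one of base [q ^+ d] and length [2 * k], whose only possible
    non-unit [1 - q ^+ n] cancels against [1 - q ^+ (2 * n)]. *)
Lemma filtration_rhs_denominator k : (k <= N)%N ->
  V 0 (qint (q ^+ 2) n * (qpoch (q ^+ (d + 1)) p k * qpoch (q ^+ (2 * d + 1)) p k)^-1).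
Proof.
move=> lekN; have := local_unit_denominator (leq_mul (leqnn 2) lekN).
rewrite qpoch_double -exprM -exprD.
have -> : (d + 1 + d = 2 * d + 1)%N by lia.
rewrite [(d * 2)%N]mulnC -/p; set D := qpoch _ _ _ * _.
have nz : 1 - q ^+ n != 0 by rewrite nE addn1.
rewrite qintE -?exprM; last exact: qX_neq1 1.
rewrite (_ : 1 - q ^+ (2 * n) = (1 - q ^+ n) * (1 + q ^+ n)); last first.
  by rewrite mulnC exprM; ring.
have v1 : V 0 (1 + q ^+ n) by apply: filtrationD.
case: ifP => _ /unitVV; rewrite ?divr1 => vD.
  by do 2!(apply: (filtrationMl filtV) => //); [apply: (filtrationMl filtV) | apply: unitVV].
have -> : (1 - q ^+ n) * (1 + q ^+ n) / (1 - q ^+ 2) / D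
  = (1 + q ^+ n) * ((D / (1 - q ^+ n))^-1 * (1 - q ^+ 2)^-1).
  by rewrite [(D / _)^-1]invfM invrK; set v := D^-1; set w := (1 - q ^+ 2)^-1; ring.
by do 2!apply: (filtrationMl filtV) => //; apply: unitVV.
Qed.

(** The deformed sums are exactly equal, and setting [x] to 1 changes either side by an element of
    [V 2] only. *)
Lemma lhs_rhs_congruence : V 2 (lhs_sum - rhs_sum).
Proof.
have d0 : (0 < d)%N by lia.
have := deformed_identity q0 qX_neq1 d0 nE; rewrite -/x -/rhs_prefactor => xE.
pose S := \sum_(k < N.+1) cq_deformed q d x k.
rewrite -[lhs_sum](subrK S) -addrA; apply: (filtrationD filtV).
  rewrite -sumrB; apply: filtration_sum => // -[k ltkN] _.
  by rewrite -opprB; apply/(filtrationN filtV)/cq_congruence.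
rewrite /S xE /rhs_sum -mulrBr -sumrB mulr_sumr.
apply: filtration_sum => // -[k ltkN] _ /=; rewrite mulrBr !rhs_coefE -mulrBr.
apply: (filtrationMl filtV); last exact: qpoch_deformation.
by apply: filtration_rhs_coef => //; apply: filtration_rhs_denominator.
Qed.

Lemma filtration_rhs_sum : V 0 rhs_sum.
Proof.
rewrite -[rhs_sum](subKr lhs_sum); apply: (filtrationB filtV).
  exact: filtration_lhs_sum.
exact: (filtrationW filtV) lhs_rhs_congruence.
Qed.

Lemma triple_sum_congruence2 : V 2 (triple_sum - rhs_sum ^+ 3).
Proof.
rewrite -[triple_sum](subrK (lhs_sum ^+ 3)) -addrA; apply: (filtrationD filtV).
  exact: (filtrationW filtV) triple_sum_congruence.
have [vl vr] := (filtration_lhs_sum, filtration_rhs_sum).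
have vlr := lhs_rhs_congruence.
rewrite !(exprSr _ 2) !expr2; apply: congruenceM => //; first exact: (filtrationMl filtV).
exact: congruenceM.
Qed.

(** The additional unit property holds at Phi_n(-q). It turns the denominators of the right-hand
    side into units, so [qint (q ^+ 2) n] puts [rhs_sum], hence [lhs_sum], into [V 1], and both
    cubes into [V 3]. *)
Lemma triple_sum_congruence3 :
    (forall m, ~~ (2 * n %| m)%N -> local_unit V (1 - q ^+ m)) ->
  V 3 (triple_sum - rhs_sum ^+ 3).
Proof.
move=> q2X_unit; have v1r : V 1 rhs_sum.
  rewrite /rhs_sum mulr_sumr; apply: filtration_sum => // -[k ltkN] _ /=.
  rewrite rhs_coefE; apply: (filtrationMr filtV); last first.
    by apply: (filtrationMl filtV); apply: filtration_qpoch; rewrite ?mul1r ?divr1.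
  apply: filtration_rhs_coef => //; apply: (filtrationMr filtV); last first.
    (* The exponents are positive and at most [2 * d * N + 1], hence below [2 * n]. *)
    by apply/unitVV/(local_unitM filtV); apply: local_unit_qpoch => // i ltik;
      rewrite -exprM -exprD; apply: q2X_unit; rewrite gtnNdvd //; nia.
  rewrite qintE -?exprM; last exact: qX_neq1 1.
  by apply: (filtrationMr filtV) => //; apply: unitVV.
have v1l : V 1 lhs_sum.
  rewrite -[lhs_sum](subrK rhs_sum); apply: (filtrationD filtV) => //.
  exact: (filtrationW filtV) lhs_rhs_congruence.
rewrite -[triple_sum](subrK (lhs_sum ^+ 3)) -addrA; apply: (filtrationD filtV).
  exact: triple_sum_congruence.
by apply: (filtrationB filtV); apply: (filtrationX filtV 3 (k := 1)).
Qed.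

End Congruence.

(** * Rational functions modulo cyclotomic polynomials *)

(* For [P] irreducible these are the powers of the maximal ideal of the local
   ring of [P]. *)
Definition vanish (P : {poly rat}) (k : nat) (x : ratfun) : Prop :=
  exists a b : {poly rat},
    [/\ b != 0, coprimep b P & x = tofrac (P ^+ k * a) / tofrac b].

Lemma vanish_poly P k a : vanish P k (tofrac (P ^+ k * a)).
Proof. by exists a, 1; rewrite oner_neq0 coprime1p tofrac1 divr1. Qed.

Lemma vanish_filtration P : filtration (vanish P).
Proof.
split.
- by move=> k; have := vanish_poly P k 0; rewrite mulr0 tofrac0.
- by have := vanish_poly P 0 1; rewrite mulr1 tofrac1.
- move=> k x y [a [b [b0 cb ->]]] [c [e [e0 ce ->]]].
  exists (a * e - c * b), (b * e); rewrite mulf_neq0 // coprimepMl cb ce; split=> //.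
  rewrite -mulNr addf_div ?tofrac_eq0 // -!tofracN -!tofracM -tofracD.
  by rewrite mulrBr !mulrA mulNr.
- move=> k l x y [a [b [b0 cb ->]]] [c [e [e0 ce ->]]].
  exists (a * c), (b * e); rewrite mulf_neq0 // coprimepMl cb ce; split=> //.
  by rewrite mulf_div -!tofracM exprD mulrACA.
- move=> k x [a [b [b0 cb ->]]]; exists (P * a), b; split=> //.
  by rewrite mulrA -exprSr.
Qed.

Lemma local_unit_poly (P b : {poly rat}) :
  b != 0 -> coprimep b P -> local_unit (vanish P) (tofrac b).
Proof.
move=> b0 cb; split; first by rewrite tofrac_eq0.
  by have := vanish_poly P 0 b; rewrite mul1r.
by exists 1, b; rewrite mulr1 tofrac1 mul1r.
Qed.

(** In lowest terms the common fraction has a denominator dividing both [b] and [e], hence coprime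
    to [P] and to [Q]. *)
Lemma ratfun_eqmod_mul (P Q : {poly rat}) k l (f g : ratfun) :
    coprimep P Q -> vanish P k (f - g) -> vanish Q l (f - g) ->
  ratfun_eqmod (P ^+ k * Q ^+ l) f g.
Proof.
move=> cPQ [a [b [b0 cb ab]]] [c [e [e0 ce ce_ab]]].
have eqE : P ^+ k * a * e = Q ^+ l * c * b.
  apply/eqP; rewrite -tofrac_eq !(tofracM _ e) !(tofracM _ b); apply/eqP.
  have : tofrac (P ^+ k * a) / tofrac b = tofrac (Q ^+ l * c) / tofrac e by rewrite -ab.
  by move/eqP; rewrite eqr_div ?tofrac_eq0 // => /eqP.
set u := P ^+ k * a in ab eqE.
set h := gcdp u b; pose u' := u %/ h; pose b' := b %/ h.
have bE : b = b' * h by rewrite divpK // dvdp_gcdr.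
have uE : u = u' * h by rewrite divpK // dvdp_gcdl.
have [b'0 h0] : b' != 0 /\ h != 0 by apply/andP; rewrite -negb_or -mulf_eq0 -bE.
have cop : coprimep u' b' by apply: coprimep_div_gcd; rewrite b0 orbT.
have eq' : u' * e = Q ^+ l * c * b'.
  by apply: (mulIf h0); rewrite mulrAC -uE eqE {1}bE mulrA.
have b'e : b' %| e.
  by rewrite -(@Gauss_dvdpr _ _ u') 1?coprimep_sym // eq' dvdp_mull.
have cb' : coprimep b' P by apply: coprimep_dvdr cb; rewrite bE dvdp_mulr.
have ce' : coprimep b' Q by apply: coprimep_dvdr ce.
have ch : coprimep (P ^+ k) h.
  by rewrite coprimep_expl // coprimep_sym; apply: coprimep_dvdr cb; rewrite dvdp_gcdr.
exists u', b'; split=> //.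
- rewrite ab uE bE (tofracM u') (tofracM b') -mulf_div divff ?mulr1 //.
  by rewrite tofrac_eq0.
(* [P ^+ k] divides [u' * h] and is coprime to [h]; [Q ^+ l] divides [u' * e] and is coprime to
   [e]. *)
- rewrite Gauss_dvdp; last by rewrite coprimep_expl // coprimep_expr.
  rewrite -(@Gauss_dvdpl _ u' h) // -uE dvdp_mulr //=.
  rewrite -(@Gauss_dvdpl _ u' e); last by rewrite coprimep_expl // coprimep_sym.
  by rewrite eq' -mulrA dvdp_mulr.
by rewrite coprimepMr !coprimep_expr.
Qed.

(** * Coprimality with Phi_n(q) and Phi_n(-q) *)

Lemma map_Phi n : (0 < n)%N ->
  exists2 z : algC, n.-primitive_root z & map_poly ratr (Phi n) = cyclotomic z n.
Proof.
move=> n0; have [z pz] := C_prim_root_exists n0; exists z => //.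
rewrite -(Cintr_Cyclotomic pz) /Phi -map_poly_comp.
by apply: eq_map_poly => c /=; rewrite ratr_int.
Qed.

Lemma Phi_dvd n : (0 < n)%N -> Phi n %| 'X^n - 1.
Proof.
move=> n0; rewrite (_ : 'X^n - 1 = map_poly intr ('X^n - 1)); last first.
  by rewrite rmorphB rmorph1 /= map_polyXn.
rewrite -prod_Cyclotomic // rmorph_prod /= (big_rem n) ?divisors_id //=.
exact: dvdp_mulr.
Qed.

(** Coprimality is invariant under field extension, and over [algC] it is the absence of common
    roots. *)
Lemma coprimep_Phi n (f : {poly rat}) : (0 < n)%N ->
    (forall z : algC, n.-primitive_root z -> (map_poly ratr f).[z] != 0) ->
  coprimep f (Phi n).
Proof.
move=> n0 nz; have [z pz PhiE] := map_Phi n0.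
rewrite coprimep_sym -(coprimep_map (ratr : {rmorphism rat -> algC})) /= PhiE.
by apply: Pdiv.ClosedField.root_coprimep => y; rewrite (root_cyclotomic pz) => /nz.
Qed.

Lemma coprimep_Phi_1BXn n m : (0 < n)%N -> ~~ (n %| m)%N ->
  coprimep (1 - 'X^m) (Phi n).
Proof.
move=> n0 ndvd; apply: coprimep_Phi => // z pz.
rewrite rmorphB rmorph1 /= map_polyXn !hornerE subr_eq0 eq_sym.
by rewrite -(prim_order_dvd pz).
Qed.

Lemma coprimep_Phi_X n : (0 < n)%N -> coprimep 'X (Phi n).
Proof.
move=> n0; apply: coprimep_Phi => // z pz; rewrite map_polyX hornerX.
apply/eqP => z0; have := prim_expr_order pz.
by rewrite z0 expr0n gtn_eqF // => /eqP; rewrite eq_sym oner_eq0.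
Qed.

(** Negating the variable is an involution that preserves Bezout relations; it moves questions about
    Phi_n(-q) back to [Phi n]. *)
Lemma coprimep_compN (f g : {poly rat}) :
  coprimep (f \Po - 'X) (g \Po - 'X) = coprimep f g.
Proof.
have main (u v : {poly rat}) : coprimep u v -> coprimep (u \Po - 'X) (v \Po - 'X).
  case/Bezout_eq1_coprimepP=> -[a b] /= e; apply/Bezout_eq1_coprimepP.
  by exists (a \Po - 'X, b \Po - 'X); rewrite /= -!comp_polyM -comp_polyD e comp_polyC.
apply/idP/idP; last exact: main.
move/main; rewrite -!comp_polyA.
by rewrite raddfN /= comp_polyX opprK !comp_polyXr.
Qed.

(** If [z] is a primitive n-th root of unity and [(- z) ^+ m = 1], squaring gives [n %| m] because
    [n] is odd; then [z ^+ m = 1] forces [m] to be even. *)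
Lemma coprimep_PhiN_1BXn n m : odd n -> ~~ (2 * n %| m)%N ->
  coprimep (1 - 'X^m) (Phi n \Po - 'X).
Proof.
move=> n_odd ndvd; have n0 := odd_gt0 n_odd.
rewrite -coprimep_compN -comp_polyA raddfN /= comp_polyX opprK comp_polyXr.
rewrite rmorphB rmorph1 /= comp_Xn_poly.
apply: coprimep_Phi => // z pz.
rewrite rmorphB rmorph1 rmorphXn rmorphN /= map_polyX !hornerE subr_eq0 eq_sym.
apply: contra ndvd => /eqP zm.
have dvdnm : (n %| m)%N.
  rewrite -(@Gauss_dvdr n 2) ?coprimen2 // (prim_order_dvd pz).
  by rewrite exprM -sqrrN -exprM mulnC exprM zm expr1n.
rewrite Gauss_dvd ?coprime2n // dvdnm andbT dvdn2.
have /eqP zm1 : z ^+ m == 1 by rewrite -(prim_order_dvd pz).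
move: zm; rewrite exprNn -signr_odd zm1 mulr1; case: odd => //= /eqP.
by rewrite expr1 eq_sym -subr_eq0 opprK (_ : 1 + 1 = 2%:R) // Num.Theory.pnatr_eq0.
Qed.

(** Phi_n(-q) divides [(- q) ^+ n - 1], which is -2 at each root of [Phi n]. *)
Lemma coprimep_PhiN_Phi n : odd n -> coprimep (Phi n \Po - 'X) (Phi n).
Proof.
move=> n_odd; have n0 := odd_gt0 n_odd.
have : coprimep (('X^n - 1) \Po - 'X) (Phi n).
  apply: coprimep_Phi => // z pz.
  rewrite rmorphB rmorph1 /= comp_Xn_poly.
  rewrite rmorphB rmorph1 rmorphXn rmorphN /= map_polyX !hornerE.
  rewrite exprNn -signr_odd n_odd (prim_expr_order pz) expr1 mulN1r.
  by rewrite -opprD oppr_eq0 (_ : 1 + 1 = 2%:R) // Num.Theory.pnatr_eq0.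
by apply: coprimep_dvdr; apply: dvdp_comp_poly; apply: Phi_dvd.
Qed.

Lemma coprimep_PhiN_X n : (0 < n)%N -> coprimep 'X (Phi n \Po - 'X).
Proof.
move=> n0; rewrite -coprimep_compN -comp_polyA raddfN /= comp_polyX opprK comp_polyXr.
by rewrite -scaleN1r coprimepZl ?oppr_eq0 ?oner_neq0 ?coprimep_Phi_X.
Qed.

Lemma Phi_dvd_1BX2n n : (0 < n)%N -> Phi n %| 1 - 'X^(2 * n).
Proof.
move=> n0; have -> : 1 - 'X^(2 * n) = ('X^n - 1) * (- (1 + 'X^n)) :> {poly rat}.
  by rewrite mulnC exprM; ring.
by rewrite dvdp_mulr ?Phi_dvd.
Qed.

Lemma PhiN_dvd_1BX2n n : (0 < n)%N -> Phi n \Po - 'X %| 1 - 'X^(2 * n).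
Proof.
move=> n0; have := dvdp_comp_poly (- 'X) (Phi_dvd_1BX2n n0).
by rewrite rmorphB rmorph1 /= comp_Xn_poly exprM sqrrN -exprM.
Qed.

Lemma vanish1_dvd (P f : {poly rat}) : P %| f -> vanish P 1 (tofrac f).
Proof. by case/dvdpP => g ->; rewrite mulrC; apply: (vanish_poly P 1). Qed.

Lemma one_sub_qvarX m : 1 - qvar ^+ m = tofrac (1 - 'X^m : {poly rat}).
Proof. by rewrite tofracB tofrac1 tofracXn. Qed.

Lemma one_sub_Xn_neq0 m : 1 - 'X^(m.+1) != 0 :> {poly rat}.
Proof. by rewrite subr_eq0 eq_sym -subr_eq0 -size_poly_eq0 -polyC1 size_XnsubC. Qed.

(** * The stated form of the right-hand side, and the case [n = 1] *)

Section Shape.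
Variable L : fieldType.
Implicit Types q : L.

Lemma rhs_sum_cube q d N n : (0 < d)%N -> n = (d * N + 1)%N ->
  (-1) ^+ ((3 * (n - 1)) %/ d) * qint (q ^+ 2) n ^+ 3
     * q ^+ ((3 * (n - 1) * (n + 1 - d)) %/ d)
     * (\sum_(0 <= k < ((n - 1) %/ d).+1)
          (qpoch (q ^+ 2) (q ^+ (2 * d)) k ^+ 2
           * qpoch (q ^+ d) (q ^+ (2 * d)) k
           * q ^+ (2 * (d - 1) * k))
          / qpochs [:: q ^+ (d + 1); q ^+ (2 * d); q ^+ (2 * d + 1)]
                   (q ^+ (2 * d)) k) ^+ 3
  = rhs_sum q d N n ^+ 3.
Proof.
move=> d0 nE; have -> : (n - 1 = N * d)%N by rewrite nE addnK mulnC.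
rewrite mulnA mulnK // mulnAC mulnK // mulnK // big_mkord /rhs_sum /rhs_prefactor.
rewrite !exprMn -!exprM ![(3 * _)%N]mulnC [(N * 3 * _)%N]mulnAC; congr (_ * _ ^+ 3).
by apply: eq_bigr => k _; rewrite /rhs_term_deformed mul1r divr1 expr2 //.
Qed.

Lemma cq0 q d : 1 + q != 0 -> cq q d 0 = 1.
Proof.
by move=> q1; rewrite /cq !qpoch0 !muln0 !expr1n !mulr1 !expr0 expr1 divff // !mul1r.
Qed.

Lemma sums_n1 q d : 1 + q != 0 ->
  triple_sum q d 1 - rhs_sum q d 0 1 ^+ 3 = 0.
Proof.
move=> q1; rewrite /triple_sum !big_ord1 big_mkcond big_ord1 /=.
rewrite cq0 // /rhs_sum /rhs_prefactor big_ord1 /qint big_ord1 /rhs_term_deformed.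
rewrite /qpochs !big_cons big_nil !qpoch0 !muln0 !mul0n !expr0 !mulr1 divr1 mulr1.
by rewrite expr1n subrr.
Qed.

End Shape.

(* The divisions by d in the exponents are exact since d divides n - 1, and
   n + 1 - d is truncated only if n = 1, where the exponent is 0 anyway. *)
Theorem theorem5p1 (n d : nat) (n_gt0 : (0 < n)%N) (n_odd : odd n)
    (d_ge3 : (3 <= d)%N) (n_mod_d : n = 1 %[mod d]) :
  ratfun_eqmod ((Phi n \Po - 'X) ^+ 3 * Phi n ^+ 2)
    (\sum_(i < n) \sum_(j < n) \sum_(s < n | (i + j + s <= n - 1)%N)
       cq qvar d i * cq qvar d j * cq qvar d s)
    ((-1) ^+ ((3 * (n - 1)) %/ d)
     * qint (qvar ^+ 2) n ^+ 3
     * qvar ^+ ((3 * (n - 1) * (n + 1 - d)) %/ d)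
     * (\sum_(0 <= k < ((n - 1) %/ d).+1)
          (qpoch (qvar ^+ 2) (qvar ^+ (2 * d)) k ^+ 2
           * qpoch (qvar ^+ d) (qvar ^+ (2 * d)) k
           * qvar ^+ (2 * (d - 1) * k))
          / qpochs [:: qvar ^+ (d + 1); qvar ^+ (2 * d); qvar ^+ (2 * d + 1)]
                   (qvar ^+ (2 * d)) k) ^+ 3).
Proof.
have d0 : (0 < d)%N by apply: leq_trans d_ge3.
pose N := (n %/ d)%N.
have nE : n = (d * N + 1)%N.
  rewrite {1}(divn_eq n d) n_mod_d modn_small; last exact: leq_trans d_ge3.
  by rewrite mulnC.
rewrite (rhs_sum_cube _ d0 nE) -/(triple_sum qvar d n).
have qXn1 m : 1 - qvar ^+ m.+1 != 0.
  by rewrite one_sub_qvarX tofrac_eq0 one_sub_Xn_neq0.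
have unitE P m : coprimep (1 - 'X^m) P -> (0 < m)%N ->
    local_unit (vanish P) (1 - qvar ^+ m).
  by case: m => // m cP _; rewrite one_sub_qvarX; apply: local_unit_poly;
    rewrite ?one_sub_Xn_neq0.
have pos e m : ~~ (e %| m)%N -> (0 < m)%N by case: m => //; rewrite dvdn0.
have X0 : 'X != 0 :> {poly rat} by rewrite polyX_eq0.
have q1 : 1 + qvar != 0 := oneD_neq0 (qXn1 1%N).
(* The congruences require [N > 0]; for [N = 0], that is [n = 1], both sides equal 1. *)
have trivial_case P k : N = 0 ->
    vanish P k (triple_sum qvar d n - rhs_sum qvar d N n ^+ 3).
  move=> N0; have n1 : n = 1%N by rewrite nE N0 muln0.
  by rewrite N0 n1 sums_n1 //; apply: filtration_zero (vanish_filtration P) k.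
apply: ratfun_eqmod_mul; first exact: coprimep_PhiN_Phi.
- case: (posnP N) => [N0 | N0]; first exact: trivial_case.
  apply: (triple_sum_congruence3 (vanish_filtration _) d_ge3 N0 n_odd nE qXn1).
  + exact/(local_unit_poly X0)/coprimep_PhiN_X.
  + move=> m ndvd; apply: unitE (pos _ _ ndvd); apply: coprimep_PhiN_1BXn => //.
    by apply: contra ndvd; apply: dvdn_trans; apply: dvdn_mull.
  + by rewrite one_sub_qvarX; apply/vanish1_dvd/PhiN_dvd_1BX2n.
  by move=> m ndvd; apply: unitE (pos _ _ ndvd); apply: coprimep_PhiN_1BXn.
case: (posnP N) => [N0 | N0]; first exact: trivial_case.
apply: (triple_sum_congruence2 (vanish_filtration _) d_ge3 N0 n_odd nE qXn1).
- exact/(local_unit_poly X0)/coprimep_Phi_X.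
- by move=> m ndvd; apply: unitE (pos _ _ ndvd); apply: coprimep_Phi_1BXn.
by rewrite one_sub_qvarX; apply/vanish1_dvd/Phi_dvd_1BX2n.
Qed.
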